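(* Let $G$ be an $n$-vertex graph and let $0\le\alpha\le1$. Then the following hold. (i) Let $\ell\ge2$ be an integer. If $G$ is $(K_1\vee P_\ell)$-free, then $$\rho_\alpha(G)\le\begin{cases}\dfrac n2+\dfrac{\ell-2}{2}, & 0\le\alpha\le\frac12,\\[4pt] (2\alpha-1)(n-1)+(1-\alpha)(n+\ell-2), & \frac12\le\alpha\le1.\end{cases}$$ In particular, for fixed $\ell$, $\rho_\alpha(G)\le\max\{\alpha,1/2\}\,n+O_\ell(1)$, and this is asymptotically sharp: for every $n$ and $\alpha$ the maximum of $\rho_\alpha$ over all $n$-vertex $(K_1\vee P_\ell)$-free graphs is at least $\max\{\alpha,1/2\}\,n-O(1)$. (ii) Let $s\ge1$ be an integer. If $G$ is $F_s$-free, then $$\rho_\alpha(G)\le\begin{cases}\dfrac n2+s-1, & 0\le\alpha\le\frac12,\\[4pt] (2\alpha-1)(n-1)+(1-\alpha)(n+2s-2), & \frac12\le\alpha\le1.\end{cases}$$ In particular, for fixed $s$, $\rho_\alpha(G)\le\max\{\alpha,1/2\}\,n+O_s(1)$, and this is asymptotically sharp: for every $n$ and $\alpha$ the maximum of $\rho_\alpha$ over all $n$-vertex $F_s$-free graphs is at least $\max\{\alpha,1/2\}\,n-O(1)$.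
   Context: All graphs are finite and simple; a graph is $F$-free if it contains no (not necessarily induced) subgraph isomorphic to $F$. $A_\alpha(G)=\alpha D(G)+(1-\alpha)A(G)$, where $A(G)$ is the adjacency matrix and $D(G)$ the diagonal degree matrix; $\rho_\alpha(G)$ is its largest eigenvalue. $P_\ell$ is the path on $\ell$ vertices, $K_1\vee P_\ell$ is obtained from $P_\ell$ by adding one new vertex adjacent to all its vertices, and $F_s$ is the friendship graph consisting of $s$ triangles sharing exactly one common vertex. The constants in $O_\ell(1)$, $O_s(1)$ depend only on $\ell$, respectively $s$, and those in $O(1)$ are absolute (all uniform in $\alpha$ and $n$). *)

(* Defs.v *)
From HB Require Import structures.
From mathcomp Require Import all_boot all_order all_algebra.
From mathcomp Require Import boolp classical_sets reals.

Set Implicit Arguments.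
Unset Strict Implicit.
Unset Printing Implicit Defensive.

Import Order.TTheory GRing.Theory Num.Theory.

Local Open Scope ring_scope.
Local Open Scope classical_set_scope.

Record sgraph (V : finType) := SGraph {
  adj :> rel V;
  adj_sym : symmetric adj;
  adj_irr : irreflexive adj
}.

(* F is isomorphic to a (not necessarily induced) subgraph of G. *)
Definition contains_copy (W V : finType) (F : sgraph W) (G : sgraph V) : Prop :=
  exists2 f : W -> V, injective f & forall x y, F x y -> G (f x) (f y).

Definition graph_free (W V : finType) (F : sgraph W) (G : sgraph V) : Prop :=
  ~ contains_copy F G.

Section Path.
Variable l : nat.

Definition path_adj : rel 'I_l :=
  fun i j => (i.+1 == j :> nat) || (j.+1 == i :> nat).

Lemma path_adj_sym : symmetric path_adj.
Proof. by move=> i j; rewrite /path_adj orbC. Qed.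

Lemma path_adj_irr : irreflexive path_adj.
Proof. by move=> i; rewrite /path_adj orbb gtn_eqF. Qed.

Definition path_graph : sgraph 'I_l := SGraph path_adj_sym path_adj_irr.
End Path.

(* K_1 v H: the vertex None is new and joined to every vertex of H. *)
Section Cone.
Variables (V : finType) (H : sgraph V).

Definition cone_adj : rel (option V) := fun x y =>
  match x, y with
  | Some u, Some v => H u v
  | None, None => false
  | _, _ => true
  end.

Lemma cone_adj_sym : symmetric cone_adj.
Proof. by case=> [u|] [v|] //=; apply: adj_sym. Qed.

Lemma cone_adj_irr : irreflexive cone_adj.
Proof. by case=> [u|] //=; apply: adj_irr. Qed.

Definition cone : sgraph (option V) := SGraph cone_adj_sym cone_adj_irr.
End Cone.

(* F_s: the i-th triangle has vertices None, Some (i, false), Some (i, true). *)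
Section Friendship.
Variable s : nat.

Definition triangle (i : 'I_s) : {set option ('I_s * bool)} :=
  [set None; Some (i, false); Some (i, true)]%SET.

Definition friendship_adj : rel (option ('I_s * bool)) := fun x y =>
  (x != y) && [exists i, (x \in triangle i) && (y \in triangle i)].

Lemma friendship_adj_sym : symmetric friendship_adj.
Proof.
move=> x y; rewrite /friendship_adj eq_sym; congr (_ && _).
by apply: eq_existsb => i; rewrite andbC.
Qed.

Lemma friendship_adj_irr : irreflexive friendship_adj.
Proof. by move=> x; rewrite /friendship_adj eqxx. Qed.

Definition friendship_graph : sgraph (option ('I_s * bool)) :=
  SGraph friendship_adj_sym friendship_adj_irr.
End Friendship.

Section Spectrum.
Variable R : realType.

(* The matrices below are real symmetric, so for n > 0 the set of (real)
   eigenvalues is finite and nonempty and its supremum is its maximum. *)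
Definition largest_eigenvalue n (M : 'M[R]_n) : R :=
  sup [set x | eigenvalue M x].

Variable n : nat.
Implicit Types (G : sgraph 'I_n) (a : R).

Definition adj_mx G : 'M[R]_n := \matrix_(i, j) (G i j)%:R.

Definition degree G (i : 'I_n) : nat := #|[set j | G i j]%SET|.

Definition degree_mx G : 'M[R]_n := diag_mx (\row_i (degree G i)%:R).

Definition A_alpha a G : 'M[R]_n :=
  a *: degree_mx G + (1 - a) *: adj_mx G.

Definition rho_alpha a G : R := largest_eigenvalue (A_alpha a G).

Definition is_maximum (S : set R) (m : R) : Prop := S m /\ ubound S m.

(* m is the maximum of rho_alpha over all n-vertex F-free graphs. *)
Definition is_max_rho_alpha (W : finType) (F : sgraph W) a (m : R) : Prop :=
  is_maximum [set rho_alpha a G | G in [set G : sgraph 'I_n | graph_free F G]] m.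
End Spectrum.

Arguments is_max_rho_alpha {R} n {W} F a m.

(* Main.v *)
Require Import Defs.
From HB Require Import structures.
From mathcomp Require Import all_boot all_order all_algebra.
From mathcomp Require Import boolp classical_sets reals.
From mathcomp Require Import zify lra.

Set Implicit Arguments.
Unset Strict Implicit.
Unset Printing Implicit Defensive.

Import Order.TTheory GRing.Theory Num.Theory.

Local Open Scope ring_scope.

(** Upper bounds.  Write d(v) for the degree of v.  If G contains no copy of
K_1 v P_(l+2), then the graph induced on any neighbourhood N(v) contains no
path on l+2 vertices, so by the Erdos-Gallai theorem ([erdos_gallai]) its
degrees add up to at most l d(v).  Hence the neighbours u of v have total
degree at most l d(v) + (n - d(v)) d(v): each u sends at most n - d(v) edges
out of N(v) ([sum_degree_nbhd]).

This controls the quadratic forms B(x) = x^T A x and E(x) = x^T D x.  For an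
edge uv, 2 x_u x_v <= x_u^2 d(v)/d(u) + x_v^2 d(u)/d(v); summing over the edges
gives B(x) <= sum_u x_u^2 m(u), where m(u) is the average degree of the
neighbours of u, and d(u) + m(u) <= n + l by the previous paragraph.  Thus
B + E <= (n + l) |x|^2 ([signless_form_le]).  Also B <= E, since D - A is
positive semidefinite, and E <= (n - 1) |x|^2.  An eigenvector x for mu
satisfies mu |x|^2 = a E + (1 - a) B.  If a <= 1/2 this is at most (E + B)/2,
because E - B >= 0; if a >= 1/2 it equals (2a - 1) E + (1 - a)(E + B).  These
are the two cases of the bound ([eigenvalue_le]); as it is proved for every
eigenvector, no spectral theorem enters.

A path on 2s vertices contains a matching of size s, so K_1 v P_(2s) contains
F_s ([friendship_in_cone_path]), and the bound for F_s-free graphs is the case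
l + 2 = 2s of the bound for K_1 v P_(l+2).

Lower bounds.  Both forbidden graphs contain a triangle, so complete bipartite
graphs K_(p,q) are admissible.  The quadratic
t^2 - a (p + q) t + (2a - 1) p q is the characteristic polynomial of the
quotient matrix of the bipartition, so its larger root is an eigenvalue of
A_a(K_(p,q)); it is at least any t at which the quadratic is nonpositive
([rho_cut_ge]).  Take t = a (n - 1) for the star if a >= 1/2, and t = floor(n/2)
for the balanced graph otherwise ([cut_rho_large]).  The maximum over all
admissible graphs exists because there are finitely many graphs on a given
vertex set. *)

(** * The Erdos-Gallai theorem for paths *)

Section ErdosGallai.
Local Open Scope nat_scope.
Variables (V : finType) (G : sgraph V).
Implicit Types (S T : {set V}) (x y z : V) (p : seq V).

Definition nbhd_in S x : {set V} := [set y in S | G x y]%SET.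

Definition simple_path_in S x p :=
  [&& path G x p, uniq (x :: p) & all [in S] (x :: p)].

Lemma longest_path S x0 : x0 \in S ->
  exists x p, simple_path_in S x p /\
    forall y q, simple_path_in S y q -> size q <= size p.
Proof.
move=> Sx0.
pose P m := `[< exists x p, simple_path_in S x p /\ size p = m >].
have exP : exists m, P m.
  by exists 0; apply/asboolP; exists x0, [::]; rewrite /simple_path_in /= Sx0.
have ubP m : P m -> m <= #|V|.
  case/asboolP=> x [p [/and3P[_ /= /andP[_ Up] _] <-]].
  by rewrite -(card_uniqP Up) max_card.
case: (ex_maxnP exP ubP) => m /asboolP[x [p [xp <-]]] max.
by exists x, p; split=> // y q yq; apply: max; apply/asboolP; exists y, q.
Qed.

(** The rotation step: if the first vertex is adjacent to y and the last one to
the predecessor of y, then traversing the final segment backwards closes the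
path up into a cycle on the same vertices. *)
Lemma cycle_of_crossing x p1 y p2 :
  path G x (p1 ++ y :: p2) -> G x y -> G (last y p2) (last x p1) ->
  cycle G (x :: p1 ++ rev (y :: p2)).
Proof.
move=> + xy wp; rewrite cat_path /= => /and3P[xp1 _ yp2].
rewrite rcons_cat cat_path xp1 lastI rev_rcons /= adj_sym wp /=.
rewrite rcons_path rev_path.
have -> : path (fun z t => G t z) y p2 = path G y p2.
  by apply: eq_path => z t; rewrite adj_sym.
rewrite yp2 /=.
case: p2 {yp2 wp} => [|z p2] /=; first by rewrite adj_sym.
by rewrite rev_cons last_rcons adj_sym.
Qed.

(** By maximality all neighbours of both ends lie on the path.  The positions
before a neighbour of the first end and the positions of the neighbours of the
last end are subsets of the [size p] positions other than the last one; since
their sizes add up to more than [size p], they meet. *)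
Lemma longest_path_crossing S x p :
  simple_path_in S x p ->
  (forall y q, simple_path_in S y q -> size q <= size p) ->
  size p < #|nbhd_in S x| + #|nbhd_in S (last x p)| ->
  exists p1 y p2, [/\ p = p1 ++ y :: p2, G x y & G (last y p2) (last x p1)].
Proof.
move=> /and3P[xp Uxp Sxp] max ltp.
have degx : #|nbhd_in S x| <= count (G x) p.
  rewrite -size_filter -(card_uniqP _); last first.
    by rewrite filter_uniq //; case/andP: Uxp.
  apply/subset_leq_card/fintype.subsetP => z; rewrite inE mem_filter => /andP[Sz xz].
  rewrite xz /=; case: (boolP (z \in x :: p)) => [|zp].
    by rewrite inE => /predU1P[zx|//]; rewrite zx adj_irr in xz.
  suff: simple_path_in S z (x :: p) by move/max; rewrite ltnn.
  by rewrite /simple_path_in /= adj_sym xz xp /= zp Sz /=; move: Uxp Sxp => /= -> ->.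
have degw : #|nbhd_in S (last x p)| <= count (G (last x p)) (belast x p).
  rewrite -size_filter -(card_uniqP _); last first.
    by rewrite filter_uniq //; move: Uxp; rewrite lastI rcons_uniq => /andP[].
  apply/subset_leq_card/fintype.subsetP => z; rewrite inE mem_filter => /andP[Sz wz].
  rewrite wz /=; case: (boolP (z \in x :: p)) => [|zp].
    rewrite lastI mem_rcons inE => /predU1P[zx|//].
    by rewrite zx adj_irr in wz.
  suff: simple_path_in S x (rcons p z) by move/max; rewrite size_rcons ltnn.
  rewrite /simple_path_in rcons_path xp wz -rcons_cons rcons_uniq zp Uxp.
  by rewrite all_rcons Sxp /= Sz.
pose q := zip p (belast x p).
have sq : size p = size (belast x p) by rewrite size_belast.
have: 0 < count (predI (G x \o fst) (G (last x p) \o snd)) q.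
  (* q lists the consecutive pairs of the path, successor first. *)
  have := count_predUI (G x \o fst) (G (last x p) \o snd) q.
  have := count_size (predU (G x \o fst) (G (last x p) \o snd)) q.
  rewrite -[count (_ \o fst) q]count_map -[count (_ \o snd) q]count_map.
  rewrite -/(unzip1 _) -/(unzip2 _) unzip1_zip ?unzip2_zip ?sq //.
  rewrite size_zip -sq minnn => h1 h2; lia.
rewrite -has_count => /(has_nthP (x, x))[i].
rewrite size_zip -sq minnn => ip; rewrite nth_zip //= => /andP[xy wy].
exists (take i p), (nth x p i), (drop i.+1 p).
have pE : p = take i p ++ nth x p i :: drop i.+1 p.
  by rewrite -drop_nth // cat_take_drop.
split=> //.
have -> : last (nth x p i) (drop i.+1 p) = last x p.
  by rewrite [in RHS]pE last_cat.
have <- // : nth x (belast x p) i = last x (take i p).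
rewrite [in LHS]pE belast_cat /= nth_cat size_belast (size_takel (ltnW ip)).
by rewrite ltnn subnn.
Qed.

(** A neighbour in S off the path of some vertex on it would extend the cycle of
[cycle_of_crossing], opened at that vertex, to a longer path. *)
Lemma longest_path_closed S x p :
  simple_path_in S x p ->
  (forall y q, simple_path_in S y q -> size q <= size p) ->
  size p < #|nbhd_in S x| + #|nbhd_in S (last x p)| ->
  forall y z, y \in x :: p -> z \in S -> G y z -> z \in x :: p.
Proof.
move=> xp max ltp y z yp Sz yz.
have [p1 [t [p2 [pE xt wp]]]] := longest_path_crossing xp max ltp.
case/and3P: xp => xp Uxp Sxp.
have := xp; rewrite {1}pE => /cycle_of_crossing/(_ xt wp).
set c := _ :: _ => cyc.
have pc : perm_eq (x :: p) c.
  by rewrite pE /c perm_cons perm_cat2l perm_sym perm_rev.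
move: (yp); rewrite (perm_mem pc) => /rot_to[i q cE].
have pq : perm_eq (x :: p) (y :: q) by rewrite -cE perm_sym perm_rot perm_sym.
apply/negPn/negP => zp.
suff: simple_path_in S z (y :: q).
  by move/max; rewrite -(perm_size pq) /= ltnn.
have yq : path G y q.
  by move: cyc; rewrite -(rot_cycle i) cE /= rcons_path => /andP[].
apply/and3P; split; first by rewrite /= adj_sym yz.
  by rewrite cons_uniq -(perm_mem pq) zp -(perm_uniq pq).
by rewrite [all _ _]/= Sz; move: Sxp; rewrite (perm_all _ pq).
Qed.

Lemma edge_sumE S : \sum_(x in S) #|nbhd_in S x| =
  \sum_(x in S) \sum_(y in S) G x y.
Proof.
apply: eq_bigr => x _; rewrite -sum1_card big_mkcond [RHS]big_mkcond /=.
by apply: eq_bigr => y _; rewrite inE; case: (y \in S) => //; case: (G x y).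
Qed.

Lemma edge_sum_setD1 S x : x \in S ->
  \sum_(y in S) #|nbhd_in S y| =
  #|nbhd_in S x|.*2 + \sum_(y in S :\ x) #|nbhd_in (S :\ x) y|.
Proof.
move=> Sx; rewrite !edge_sumE (big_setD1 x Sx) /=.
have degE : \sum_(y in S :\ x) G x y = #|nbhd_in S x|.
  rewrite -sum1_card big_mkcond [RHS]big_mkcond /=.
  apply: eq_bigr => y _; rewrite !inE.
  case: eqVneq => [->|_] /=; first by rewrite adj_irr andbF.
  by case: (y \in S) => //; case: (G x y).
have -> : \sum_(y in S) G x y = #|nbhd_in S x|.
  by rewrite (big_setD1 x Sx) /= adj_irr add0n.
have -> : \sum_(y in S :\ x) \sum_(z in S) G y z =
    \sum_(y in S :\ x) G x y + \sum_(y in S :\ x) \sum_(z in S :\ x) G y z.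
  rewrite -big_split /=; apply: eq_bigr => y _.
  by rewrite (big_setD1 x Sx) /= adj_sym.
by rewrite degE addnA addnn.
Qed.

Lemma edge_sum_closed S T : T \subset S ->
  (forall y z, y \in T -> z \in S -> G y z -> z \in T) ->
  \sum_(x in S) #|nbhd_in S x| =
  \sum_(x in T) #|nbhd_in T x| + \sum_(x in S :\: T) #|nbhd_in (S :\: T) x|.
Proof.
move=> TS clT; rewrite (big_setID T) /=; have /finset.setIidPr -> := TS.
congr (_ + _); apply: eq_bigr => x xT; apply: eq_card => y; rewrite !inE.
  case: (boolP (G x y)) => xy; rewrite ?andbF // !andbT.
  apply/idP/idP => [yS|]; first exact: clT xT yS xy.
  exact: (fintype.subsetP TS).
case: (boolP (G x y)) => xy; rewrite ?andbF // !andbT.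
case: (boolP (y \in T)) => //= yT.
move: xT; rewrite inE => /andP[/negP xT xS]; case: xT.
by apply: clT yT xS _; rewrite adj_sym.
Qed.

(** Induction on S.  A vertex of degree at most l/2 can be deleted, which removes
at most l from the degree sum.  Otherwise the vertex set of a longest path is a
union of components by [longest_path_closed]; it has at most l+1 vertices, so
its degrees are at most l and it can be deleted as well. *)
Theorem erdos_gallai l S :
  (forall x p, simple_path_in S x p -> size p <= l) ->
  \sum_(x in S) #|nbhd_in S x| <= l * #|S|.
Proof.
elim: {S}_.+1 {-2}S (ltnSn #|S|) => // m IH S; rewrite ltnS => Sm Pl.
have sub T : T \subset S -> forall x p, simple_path_in T x p -> size p <= l.
  move=> TS x p /and3P[xp Up Tp]; apply: (Pl x p); apply/and3P; split=> //.
  by apply: sub_all Tp => y; apply: (fintype.subsetP TS).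
have [->|[x0 Sx0]] := finset.set_0Vmem S; first by rewrite big_set0.
case: (boolP [exists x in S, #|nbhd_in S x|.*2 <= l]) => [/exists_inP[x Sx dx]|].
  rewrite (edge_sum_setD1 Sx) [#|S|](cardsD1 x) Sx mulnDr muln1 leq_add //.
  apply: IH; last by apply: sub; rewrite finset.subD1set.
  by move: Sm; rewrite (cardsD1 x) Sx.
move=> /exists_inPn mindeg.
have [x [p [xp max]]] := longest_path Sx0.
pose T : {set V} := [set y in x :: p]%SET.
have [_ Up /allP Sp] := and3P xp.
have TS : T \subset S by apply/fintype.subsetP => y; rewrite inE; apply: Sp.
have cT : #|T| = (size p).+1 by rewrite cardsE (card_uniqP Up).
have pl := Pl x p xp.
have Sx : x \in S by apply: Sp; rewrite mem_head.
have Sw : last x p \in S by apply: Sp; rewrite mem_last.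
rewrite (edge_sum_closed TS); last first.
  move=> y z; rewrite !inE; apply: (longest_path_closed xp max).
  have := mindeg _ Sx; have := mindeg _ Sw; move: pl; rewrite -!ltnNge; lia.
have -> : #|S| = #|T| + #|S :\: T|.
  by rewrite -(cardsID T S); have /finset.setIidPr -> := TS.
rewrite mulnDr leq_add //.
  rewrite mulnC -sum_nat_const; apply: leq_sum => y Ty.
  rewrite (leq_trans _ pl) // -ltnS -cT [#|T|](cardsD1 y) Ty ltnS subset_leq_card //.
  apply/fintype.subsetP => z; rewrite !inE => /andP[-> yz]; rewrite andbT.
  by apply/eqP => zy; rewrite zy adj_irr in yz.
apply: IH; last by apply: sub; rewrite finset.subsetDl.
move: (cardsID T S); have /finset.setIidPr -> := TS.
rewrite cT; lia.
Qed.
End ErdosGallai.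

(** * Degrees in the neighbourhood of a vertex *)

Definition nbhd (V : finType) (G : sgraph V) x : {set V} := [set y | G x y]%SET.

Lemma nbhd_in_nbhd (V : finType) (G : sgraph V) x y :
  nbhd_in G (nbhd G x) y = (nbhd G y :&: nbhd G x)%SET.
Proof. by apply/setP => z; rewrite !inE andbC. Qed.

Section LocalDegree.
Local Open Scope nat_scope.
Variables (V : finType) (G : sgraph V) (l : nat).
Hypothesis Gfree : graph_free (cone (path_graph l.+2)) G.

Lemma cone_path_free_nbhd v x p : simple_path_in G (nbhd G v) x p -> size p <= l.
Proof.
case/and3P=> /(pathP x) xp Up /allP Np; rewrite leqNgt; apply/negP => lp.
apply: Gfree.
have lt_i (i : 'I_l.+2) : i < size (x :: p) by rewrite (leq_trans (ltn_ord i)).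
have vN (i : 'I_l.+2) : G v (nth x (x :: p) i).
  by have := Np _ (mem_nth x (lt_i i)); rewrite inE.
exists (fun o => if o is Some i then nth x (x :: p) (i : 'I_l.+2) else v).
  case=> [i|] [j|] //= => [|vi|vj].
  - by move/eqP; rewrite nth_uniq ?lt_i // => /eqP/val_inj->.
  - by have := vN i; rewrite vi adj_irr.
  - by have := vN j; rewrite -vj adj_irr.
case=> [i|] [j|] // => [|_]; last by rewrite adj_sym; apply: vN.
rewrite /= /path_adj => /orP[]/eqP ij.
  by rewrite -ij; apply: xp; rewrite -ltnS ij; apply: (lt_i j).
by rewrite -ij adj_sym; apply: xp; rewrite -ltnS ij; apply: (lt_i i).
Qed.

(** Edges from N(v) back into N(v) are counted by [erdos_gallai]; each neighbour
of v has at most |V| - d(v) neighbours elsewhere. *)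
Lemma sum_degree_nbhd v :
  \sum_(u in nbhd G v) #|nbhd G u| + #|nbhd G v| ^ 2 <=
  (#|V| + l) * #|nbhd G v|.
Proof.
have eg := erdos_gallai (@cone_path_free_nbhd v).
have -> : \sum_(u in nbhd G v) #|nbhd G u| =
    \sum_(u in nbhd G v) #|nbhd_in G (nbhd G v) u| +
    \sum_(u in nbhd G v) #|nbhd G u :\: nbhd G v|.
  rewrite -big_split /=; apply: eq_bigr => u _.
  by rewrite nbhd_in_nbhd cardsID.
have out : \sum_(u in nbhd G v) #|nbhd G u :\: nbhd G v| <=
    (#|V| - #|nbhd G v|) * #|nbhd G v|.
  rewrite mulnC -sum_nat_const; apply: leq_sum => u _.
  have := cardsC (nbhd G v); rewrite addnC => <-; rewrite addnK.
  by rewrite subset_leq_card // finset.setDE finset.subsetIr.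
have := max_card (mem (nbhd G v)).
move: eg out; set d := #|nbhd G v|.
rewrite mulnDl -mulnn mulnBl => eg out dV.
have : d * d <= #|V| * d by rewrite leq_mul2r dV orbT.
lia.
Qed.
End LocalDegree.

(** * Quadratic forms of the adjacency and degree matrices *)

Section QuadraticForms.
Variables (R : realFieldType) (V : finType) (G : sgraph V).
Implicit Types x : V -> R.

Definition adj_form x : R := \sum_u \sum_(v in nbhd G u) x u * x v.
Definition degree_form x : R := \sum_u #|nbhd G u|%:R * x u ^+ 2.

Lemma sum_nbhd_sym (f : V -> V -> R) :
  \sum_u \sum_(v in nbhd G u) f u v = \sum_u \sum_(v in nbhd G u) f v u.
Proof.
rewrite (exchange_big_dep xpredT) //=; apply: eq_bigr => u _.
by apply: eq_bigl => v; rewrite !inE adj_sym.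
Qed.

Lemma degree_formE x : degree_form x = \sum_u \sum_(v in nbhd G u) x u ^+ 2.
Proof. by apply: eq_bigr => u _; rewrite sumr_const mulr_natl. Qed.

(** Each edge contributes 2 x_u x_v to the form, which may be split unevenly
between its two orientations. *)
Lemma adj_form_weighted x (t : V -> V -> R) :
  (forall u v, G u v -> 2 * (x u * x v) <= t u v + t v u) ->
  adj_form x <= \sum_u \sum_(v in nbhd G u) t u v.
Proof.
move=> xt; set T := \sum_u _.
have : 2 * adj_form x <= T + T.
  rewrite {2}/T sum_nbhd_sym -big_split mulr_sumr; apply: ler_sum => u _.
  rewrite -big_split mulr_sumr; apply: ler_sum => v; rewrite inE; apply: xt.
lra.
Qed.

(** The difference is the Laplacian form, the sum of (x_u - x_v)^2 over edges. *)
Lemma adj_form_le_degree x : adj_form x <= degree_form x.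
Proof.
rewrite degree_formE; apply: adj_form_weighted => u v _.
have := sqr_ge0 (x u - x v); rewrite sqrrB; lra.
Qed.

Lemma degree_form_le x :
  degree_form x <= (#|V|%:R - 1) * \sum_u x u ^+ 2.
Proof.
rewrite mulr_sumr; apply: ler_sum => u _; apply: ler_wpM2r; first exact: sqr_ge0.
rewrite lerBrDr natr1 ler_nat -cardsT; apply: proper_card.
by apply/properP; split; [apply: finset.subsetT | exists u; rewrite inE ?adj_irr].
Qed.

(** The weighted AM-GM inequality with ratio d(v)/d(u) bounds the adjacency form
by the sum of x_u^2 m(u), where m(u) is the average degree of the neighbours of
u; the hypothesis says that d(u) + m(u) <= c at every non-isolated u. *)
Lemma signless_form_le (c : R) x : 0 <= c ->
  (forall u, \sum_(v in nbhd G u) #|nbhd G v|%:R + #|nbhd G u|%:R ^+ 2 <=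
     c * #|nbhd G u|%:R) ->
  adj_form x + degree_form x <= c * \sum_u x u ^+ 2.
Proof.
move=> c0 dc; pose d u : R := #|nbhd G u|%:R.
have d_gt0 u v : G u v -> 0 < d u.
  by move=> uv; rewrite ltr0n; apply/card_gt0P; exists v; rewrite inE.
have wt : adj_form x <= \sum_u \sum_(v in nbhd G u) (x u ^+ 2 * (d v / d u)).
  apply: adj_form_weighted => u v uv.
  have du := d_gt0 _ _ uv; have dv : 0 < d v by apply: (d_gt0 v u); rewrite adj_sym.
  have r0 : 0 < d v / d u by rewrite divr_gt0.
  have -> : d u / d v = (d v / d u)^-1 by rewrite invf_div.
  move: (d v / d u) r0 => r r0; rewrite -(ler_pM2r r0) [leRHS]mulrDl.
  rewrite divfK ?gt_eqF //.
  have := sqr_ge0 (x u * r - x v); rewrite sqrrB !exprMn; lra.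
rewrite -lerBrDr; apply: (le_trans wt).
rewrite lerBrDr -big_split mulr_sumr; apply: ler_sum => u _ /=.
rewrite -mulr_sumr mulrC -mulrDl ler_wpM2r ?sqr_ge0 //.
rewrite -mulr_suml -/(d u).
have [du0|du0] := eqVneq (d u) 0; first by rewrite du0 invr0 mulr0 addr0.
have du : 0 < d u by rewrite lt0r du0 /= ler0n.
rewrite -(ler_pM2r du) mulrDl -mulrA mulVf // mulr1.
by rewrite -expr2; apply: dc.
Qed.
End QuadraticForms.

(** * Eigenvalues of A_alpha *)

Section AlphaSpectrum.
Variables (R : realType) (n : nat).
Implicit Types (G : sgraph 'I_n) (a mu : R).

Lemma A_alphaE a G (v : 'rV[R]_n) j :
  (v *m A_alpha a G) 0 j =
  a * (#|nbhd G j|%:R * v 0 j) + (1 - a) * \sum_(i in nbhd G j) v 0 i.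
Proof.
rewrite /A_alpha /degree_mx mulmxDr -!scalemxAr mul_mx_diag !mxE.
congr (_ * _ + _ * _); first by rewrite mulrC.
rewrite [RHS]big_mkcond; apply: eq_bigr => i _; rewrite !mxE inE adj_sym.
by case: (G j i); rewrite ?mulr1 ?mulr0.
Qed.

Lemma eigenvalue_forms a G mu : eigenvalue (A_alpha a G) mu ->
  exists2 x : 'I_n -> R, 0 < \sum_u x u ^+ 2 &
    mu * (\sum_u x u ^+ 2) = a * degree_form G x + (1 - a) * adj_form G x.
Proof.
case/eigenvalueP=> v vM v0; exists (v 0).
  have ge0 i : true -> 0 <= v 0 i ^+ 2 by move=> _; apply: sqr_ge0.
  rewrite lt0r sumr_ge0 // andbT; apply: contraNneq v0 => /psumr_eq0P - /(_ ge0) v0.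
  by apply/eqP/rowP => i; rewrite mxE; apply/eqP; rewrite -sqrf_eq0 v0.
rewrite !mulr_sumr -big_split /=; apply: eq_bigr => u _.
have /rowP/(_ u) := vM; rewrite A_alphaE mxE => muv.
rewrite expr2 mulrA -muv mulrDl -mulr_sumr; congr (_ + _).
  by rewrite -!mulrA.
by rewrite -mulrA [v 0 u * _]mulrC.
Qed.

Lemma eigenvalue_le l a G mu : (0 < n)%N -> 0 <= a <= 1 ->
  graph_free (cone (path_graph l.+2)) G -> eigenvalue (A_alpha a G) mu ->
  (a <= 1 / 2 -> mu <= (n%:R + l%:R) / 2) /\
  (1 / 2 <= a -> mu <= (2 * a - 1) * (n%:R - 1) + (1 - a) * (n%:R + l%:R)).
Proof.
move=> n0 /andP[a0 a1] Gf /eigenvalue_forms[x]; set N := \sum_u _ => N0 muE.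
have BE := adj_form_le_degree G x.
have EN := degree_form_le G x; rewrite card_ord -/N in EN.
have BEN : adj_form G x + degree_form G x <= (n%:R + l%:R) * N.
  apply: signless_form_le => [|u]; first by rewrite addr_ge0.
  rewrite -natr_sum -natrX -!natrD -natrM ler_nat.
  by have := sum_degree_nbhd Gf u; rewrite card_ord.
split=> ha; rewrite -(ler_pM2r N0) muE.
  have : 0 <= (1 / 2 - a) * (degree_form G x - adj_form G x).
    by rewrite mulr_ge0 ?subr_ge0.
  lra.
have h1 : 0 <= (2 * a - 1) * ((n%:R - 1) * N - degree_form G x).
  by rewrite mulr_ge0 ?subr_ge0 //; lra.
have h2 : 0 <= (1 - a) * ((n%:R + l%:R) * N - (adj_form G x + degree_form G x)).
  by rewrite mulr_ge0 ?subr_ge0.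
lra.
Qed.

(** Nonnegativity of c covers an empty set of eigenvalues, whose supremum is 0 by
convention. *)
Lemma rho_alpha_le a G c : 0 <= c ->
  (forall mu, eigenvalue (A_alpha a G) mu -> mu <= c) -> rho_alpha a G <= c.
Proof.
move=> c0 le_c; rewrite /rho_alpha /largest_eigenvalue.
have [->|/set0P ne] := eqVneq [set x | eigenvalue (A_alpha a G) x]%classic set0.
  by rewrite sup0.
exact: ge_sup.
Qed.

(** The supremum dominates its members only if the eigenvalues are bounded.  As a
graph on n vertices has no room for K_1 v P_(n+2), [eigenvalue_le] bounds them. *)
Lemma eigenvalue_le_rho a G mu : 0 <= a <= 1 ->
  eigenvalue (A_alpha a G) mu -> mu <= rho_alpha a G.
Proof.
move=> a01 ev; apply: ub_le_sup (ev).
have Gf : graph_free (cone (path_graph n.+2)) G.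
  by case=> f /leq_card + _; rewrite card_option !card_ord; lia.
have n0 : (0 < n)%N.
  rewrite lt0n; apply/eqP => n0; case/eigenvalueP: ev => v _ /eqP[].
  by apply/rowP => i; have := ltn_ord i; rewrite {2}n0.
exists (n%:R + n%:R) => x /(eigenvalue_le n0 a01 Gf)[small large].
have n1 : 1 <= n%:R :> R by rewrite ler1n.
have [/small|/ltW ha] := leP a (1 / 2); first by lra.
apply: le_trans (large ha) _; case/andP: a01 => a0 a1.
have : 0 <= (1 - a) * n%:R by rewrite mulr_ge0 ?subr_ge0.
lra.
Qed.

(** rho_alpha depends only on the boolean adjacency matrix, which ranges over a
finite type. *)
Lemma max_rho_alpha_exists (W : finType) (F : sgraph W) a G0 :
  graph_free F G0 -> exists m : R, is_max_rho_alpha n F a m.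
Proof.
move=> F0; pose enc G : 'M[bool]_n := \matrix_(i, j) G i j.
pose rho (c : 'M[bool]_n) := largest_eigenvalue
  (a *: diag_mx (\row_i #|[set j | c i j]%SET|%:R : 'rV[R]_n) +
   (1 - a) *: \matrix_(i, j) (c i j)%:R).
have rhoE G : rho (enc G) = rho_alpha a G.
  rewrite /rho /rho_alpha /A_alpha /degree_mx /adj_mx.
  have -> : \row_i #|[set j | enc G i j]%SET|%:R =
            \row_i (degree G i)%:R :> 'rV[R]_n.
    apply/rowP => i; rewrite !mxE /degree; congr (_%:R); apply: eq_card => j.
    by rewrite !inE mxE.
  have -> // : \matrix_(i, j) (enc G i j)%:R =
               \matrix_(i, j) (G i j)%:R :> 'M[R]_n.
  by apply/matrixP => i j; rewrite !mxE.
pose P c := `[< exists2 G, graph_free F G & enc G = c >].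
have P0 : P (enc G0) by apply/asboolP; exists G0.
case: (@Order.TotalTheory.arg_maxP _ _ _ (enc G0) P rho P0) => c /asboolP[G Gf <-] max.
exists (rho_alpha a G); split; first by exists G.
by move=> _ [H Hf <-]; rewrite -!rhoE; apply: max; apply/asboolP; exists H.
Qed.
End AlphaSpectrum.

(** * Complete bipartite graphs *)

Section CutGraph.
Variables (V : finType) (A : {set V}).

Definition cut_adj : rel V := fun x y => (x \in A) != (y \in A).

Lemma cut_adj_sym : symmetric cut_adj.
Proof. by move=> x y; rewrite /cut_adj eq_sym. Qed.

Lemma cut_adj_irr : irreflexive cut_adj.
Proof. by move=> x; rewrite /cut_adj eqxx. Qed.

Definition cut_graph : sgraph V := SGraph cut_adj_sym cut_adj_irr.

Lemma cut_graph_free (W : finType) (F : sgraph W) x y z :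
  F x y -> F y z -> F x z -> graph_free F cut_graph.
Proof.
move=> xy yz xz [f _ fF]; have := fF _ _ xz; have := fF _ _ yz; have := fF _ _ xy.
by rewrite /= /cut_adj; do 3!case: (_ \in A).
Qed.

Lemma nbhd_cut x : nbhd cut_graph x = if x \in A then ~: A else A.
Proof.
by apply/setP => y; rewrite inE /= /cut_adj; case: ifP; rewrite ?inE;
   case: (y \in A).
Qed.
End CutGraph.

Section CutSpectrum.
Variables (R : realType) (n : nat) (A : {set 'I_n}).
Implicit Types a t : R.
Let p : R := #|A|%:R.
Let q : R := #|~: A|%:R.

(** Lifts an eigenvector of the quotient matrix
((a q, (1 - a) q), ((1 - a) p, a p)) to a vector constant on each side.  For
a = 1 the two sides decouple and this vector can vanish. *)
Lemma cut_eigenvalue a mu : a != 1 -> (0 < #|A|)%N -> (0 < #|~: A|)%N ->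
  mu ^+ 2 - a * (p + q) * mu + p * q * (2 * a - 1) = 0 ->
  eigenvalue (A_alpha a (cut_graph A)) mu.
Proof.
move=> a1 /card_gt0P[i iA] q0 muE; apply/eigenvalueP.
exists (\row_j if j \in A then (1 - a) * q else mu - a * q); last first.
  apply/eqP => /rowP/(_ i); rewrite !mxE iA => /eqP.
  by rewrite mulf_eq0 subr_eq0 eq_sym (negPf a1) pnatr_eq0 -[_ == 0%N]negbK -lt0n q0.
apply/rowP => j; rewrite A_alphaE !mxE nbhd_cut.
have sumA c (B : {set 'I_n}) (f : 'I_n -> R) : (forall k, k \in B -> f k = c) ->
    \sum_(k in B) f k = #|B|%:R * c.
  by move=> fc; rewrite (eq_bigr (fun=> c)) // sumr_const mulr_natl.
case: (j \in A).
  rewrite (@sumA (mu - a * q)) -/q; last first.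
    by move=> k; rewrite !inE !mxE => /negPf->.
  lra.
rewrite (@sumA ((1 - a) * q)) -/p; last by move=> k kA; rewrite mxE kA.
lra.
Qed.

Lemma rho_cut_ge a t : 0 <= a -> a < 1 -> (0 < #|A|)%N -> (0 < #|~: A|)%N ->
  t ^+ 2 - a * (p + q) * t + p * q * (2 * a - 1) <= 0 ->
  t <= rho_alpha a (cut_graph A).
Proof.
move=> a0 a1 p0 q0 tle.
pose D := (a * (p + q)) ^+ 2 - 4 * (p * q * (2 * a - 1)).
have tD : (2 * t - a * (p + q)) ^+ 2 <= D by rewrite /D; lra.
have D0 : 0 <= D := le_trans (sqr_ge0 _) tD.
have sD := sqr_sqrtr D0.
have st : 2 * t - a * (p + q) <= Num.sqrt D.
  by rewrite (le_trans (ler_norm _)) // -sqrtr_sqr ler_wsqrtr.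
apply: (@le_trans _ _ ((a * (p + q) + Num.sqrt D) / 2)); first by lra.
apply: eigenvalue_le_rho; first by rewrite a0 ltW.
apply: cut_eigenvalue => //; first by rewrite lt_eqF.
move: sD; rewrite /D; lra.
Qed.
End CutSpectrum.

Lemma degree_eigenvalue (R : realType) n (G : sgraph 'I_n) i :
  eigenvalue (A_alpha (1 : R) G) #|nbhd G i|%:R.
Proof.
apply/eigenvalueP; exists (delta_mx 0 i).
  apply/rowP => j; rewrite A_alphaE subrr mul0r addr0 mul1r !mxE eqxx /=.
  by case: eqVneq => [->|_]; rewrite ?mulr0.
by apply/eqP => /rowP/(_ i); rewrite !mxE !eqxx => /eqP; rewrite oner_eq0.
Qed.

(** The star when a >= 1/2, the balanced complete bipartite graph otherwise.  The
case a = 1, left out by [cut_eigenvalue], uses that the degree of the centre is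
an eigenvalue of the diagonal matrix D. *)
Lemma cut_rho_large (R : realType) n (a : R) : (0 < n)%N -> 0 <= a <= 1 ->
  exists A : {set 'I_n},
    Num.max a (1 / 2) * n%:R - 1 <= rho_alpha a (cut_graph A).
Proof.
case: n => // n _ /andP[a0 a1].
have cardC (A : {set 'I_n.+1}) : (#|A| + #|~: A| = n.+1)%N.
  by rewrite cardsC card_ord.
have [n0|n0] := posnP n.
  exists finset.set0; apply: (@le_trans _ _ 0).
    by rewrite n0 mulr1 subr_le0 ge_max a1 /=; lra.
  apply: eigenvalue_le_rho; first by rewrite a0.
  apply/eigenvalueP; exists (const_mx 1); last first.
    by apply/eqP => /rowP/(_ ord0); rewrite !mxE => /eqP; rewrite oner_eq0.
  apply/rowP => j; rewrite A_alphaE nbhd_cut inE cards0 big_set0 scale0r mxE.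
  by rewrite mul0r !mulr0 addr0 mxE.
have [ha|/ltW ha] := leP (1 / 2) a.
  pose A : {set 'I_n.+1} := [set ord0].
  have cA : #|A| = 1%N by rewrite cards1.
  have cCA : #|~: A| = n by have := cardC A; rewrite cA => -[].
  exists A; apply: (@le_trans _ _ (a * n%:R)); first by rewrite -natr1; lra.
  have [->|a_neq1] := eqVneq a 1.
    apply: eigenvalue_le_rho; first by rewrite ler01 lexx.
    have := degree_eigenvalue R (cut_graph A) ord0.
    by rewrite nbhd_cut !inE eqxx cCA mul1r.
  apply: rho_cut_ge; rewrite ?cA ?cCA //; first by rewrite lt_neqAle a_neq1.
  have : 0 <= n%:R * (1 - a) ^+ 2 by rewrite mulr_ge0 ?sqr_ge0.
  lra.
pose B : {set 'I_n.+1} := [set i in take n.+1./2 (enum 'I_n.+1)].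
have cB : #|B| = n.+1./2.
  rewrite cardsE (card_uniqP _) ?take_uniq ?enum_uniq //.
  by rewrite size_takel // size_enum_ord; lia.
exists B.
have cCB : #|~: B| = uphalf n.+1 by have := cardC B; rewrite cB; lia.
apply: (@le_trans _ _ (n.+1./2)%:R).
  have : (n.+1 <= n.+1./2 .*2 + 1)%N by lia.
  rewrite -(ler_nat R) natrD -muln2 natrM; lra.
apply: rho_cut_ge; rewrite ?cB ?cCB //; [by lra|by lia|].
have hle : (n.+1./2)%:R <= (uphalf n.+1)%:R :> R by rewrite ler_nat; lia.
have : 0 <= (1 - a) * (n.+1./2)%:R * ((uphalf n.+1)%:R - (n.+1./2)%:R).
  by rewrite !mulr_ge0 ?subr_ge0.
lra.
Qed.

(** * The bounds on rho_alpha *)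

Section UpperBound.
Variables (R : realType) (l n : nat) (G : sgraph 'I_n) (a : R).
Hypotheses (n0 : (0 < n)%N) (a01 : 0 <= a <= 1).
Hypothesis Gfree : graph_free (cone (path_graph l.+2)) G.

Lemma rho_alpha_bound :
  (a <= 1 / 2 -> rho_alpha a G <= (n%:R + l%:R) / 2) /\
  (1 / 2 <= a ->
     rho_alpha a G <= (2 * a - 1) * (n%:R - 1) + (1 - a) * (n%:R + l%:R)).
Proof.
split=> ha; apply: rho_alpha_le => [|mu /(eigenvalue_le n0 a01 Gfree)[le1 le2]].
- by rewrite divr_ge0 ?addr_ge0.
- exact: le1.
- have [_ a1] := andP a01.
  apply: addr_ge0; apply: mulr_ge0; rewrite ?subr_ge0 ?ler1n //; first by lra.
  exact: addr_ge0.
- exact: le2.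
Qed.

Lemma rho_alpha_bound_max : rho_alpha a G <= Num.max a (1 / 2) * n%:R + l%:R.
Proof.
have [le1 le2] := rho_alpha_bound; have l0 : 0 <= l%:R :> R by [].
have [ha|/ltW ha] := leP a (1 / 2); first by have := le1 ha; lra.
apply: le_trans (le2 ha) _; case/andP: a01 => a0 _.
have : 0 <= a * l%:R by rewrite mulr_ge0.
lra.
Qed.
End UpperBound.

Lemma max_rho_alpha_large (R : realType) (W : finType) (F : sgraph W) x y z n (a : R) :
  F x y -> F y z -> F x z -> (0 < n)%N -> 0 <= a <= 1 ->
  exists2 m : R, is_max_rho_alpha n F a m & Num.max a (1 / 2) * n%:R - 1 <= m.
Proof.
move=> xy yz xz n0 a01; have [A leA] := cut_rho_large n0 a01.
have Af := cut_graph_free (A := A) xy yz xz.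
have [m mP] := max_rho_alpha_exists a Af.
exists m => //; apply: le_trans leA _; case: mP => _; apply; by exists (cut_graph A).
Qed.

(** The i-th triangle uses the i-th edge of the perfect matching
{2i, 2i+1} of the path. *)
Lemma friendship_in_cone_path s :
  contains_copy (friendship_graph s) (cone (path_graph s.*2)).
Proof.
have lt_ib (i : 'I_s) (b : bool) : (i.*2 + b < s.*2)%N.
  by have := ltn_ord i; case: b; lia.
exists (fun o => if o is Some (i, b) then Some (Ordinal (lt_ib i b)) else None).
  case=> [[i b]|] [[j c]|] //= [] ij.
  (* Parity of a position on the path recovers which end of the edge it is. *)
  have bc : b = c by have := congr1 odd ij; rewrite !oddD !odd_double !oddb.
  by move: ij; rewrite bc => /addIn/double_inj/val_inj->.
case=> [[i b]|] [[j c]|] //=; rewrite /friendship_adj ?eqxx //.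
case/andP=> neq /existsP[k]; rewrite !inE /= => /andP[/orP ik /orP jk].
have [ik' jk'] : i = k /\ j = k.
  by split; [case: ik | case: jk] => /eqP[].
move: neq; rewrite ik' jk' /path_adj /= => neq.
have : b != c by apply: contraNneq neq => ->.
by case: b c {neq ik jk} => [] [] // _; rewrite ?addn0 ?addn1 eqxx ?orbT.
Qed.

Lemma friendship_free_cone_path s (V : finType) (G : sgraph V) :
  graph_free (friendship_graph s) G -> graph_free (cone (path_graph s.*2)) G.
Proof.
move=> Ff [f f_inj fG]; apply: Ff.
have [g g_inj gF] := friendship_in_cone_path s.
exists (f \o g); first exact: inj_comp.
by move=> x y /gF/fG.
Qed.

Theorem corollary4p6 (R : realType) :
  (* (i) *)
  [/\ forall (l n : nat) (G : sgraph 'I_n) (a : R),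
        (2 <= l)%N -> (0 < n)%N -> 0 <= a <= 1 ->
        graph_free (cone (path_graph l)) G ->
        (a <= 1 / 2 -> rho_alpha a G <= n%:R / 2 + (l%:R - 2) / 2) /\
        (1 / 2 <= a ->
           rho_alpha a G <=
             (2 * a - 1) * (n%:R - 1) + (1 - a) * (n%:R + l%:R - 2)),
      forall l : nat, (2 <= l)%N ->
        exists C : R, forall (n : nat) (G : sgraph 'I_n) (a : R),
          (0 < n)%N -> 0 <= a <= 1 ->
          graph_free (cone (path_graph l)) G ->
          rho_alpha a G <= Num.max a (1 / 2) * n%:R + C
    & exists C : R, forall (l n : nat) (a : R),
        (2 <= l)%N -> (0 < n)%N -> 0 <= a <= 1 ->
        exists2 m : R, is_max_rho_alpha n (cone (path_graph l)) a m
                     & Num.max a (1 / 2) * n%:R - C <= m]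
  /\
  (* (ii) *)
  [/\ forall (s n : nat) (G : sgraph 'I_n) (a : R),
        (1 <= s)%N -> (0 < n)%N -> 0 <= a <= 1 ->
        graph_free (friendship_graph s) G ->
        (a <= 1 / 2 -> rho_alpha a G <= n%:R / 2 + s%:R - 1) /\
        (1 / 2 <= a ->
           rho_alpha a G <=
             (2 * a - 1) * (n%:R - 1) + (1 - a) * (n%:R + 2 * s%:R - 2)),
      forall s : nat, (1 <= s)%N ->
        exists C : R, forall (n : nat) (G : sgraph 'I_n) (a : R),
          (0 < n)%N -> 0 <= a <= 1 ->
          graph_free (friendship_graph s) G ->
          rho_alpha a G <= Num.max a (1 / 2) * n%:R + C
    & exists C : R, forall (s n : nat) (a : R),
        (1 <= s)%N -> (0 < n)%N -> 0 <= a <= 1 ->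
        exists2 m : R, is_max_rho_alpha n (friendship_graph s) a m
                     & Num.max a (1 / 2) * n%:R - C <= m].
Proof.
split; split.
- case=> [|[|l]] // n G a _ n0 a01 Gf; have [le1 le2] := rho_alpha_bound n0 a01 Gf.
  by split=> [/le1|/le2]; rewrite -[l.+2]addn2 natrD; lra.
- case=> [|[|l]] // _; exists l%:R => n G a n0 a01 Gf.
  exact: rho_alpha_bound_max n0 a01 Gf.
- exists 1; case=> [|[|l]] // n a _ n0 a01.
  pose i1 : 'I_l.+2 := lift ord0 ord0.
  exact: (@max_rho_alpha_large _ _ _ None (Some ord0) (Some i1)).
- case=> // s n G a _ n0 a01 /friendship_free_cone_path Gf.
  have [le1 le2] := @rho_alpha_bound R s.*2 n G a n0 a01 Gf.
  by split=> [/le1|/le2]; rewrite -addnn -[s.+1]addn1 !natrD; lra.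
- case=> // s _; exists (s.*2)%:R => n G a n0 a01 /friendship_free_cone_path Gf.
  exact: (@rho_alpha_bound_max R s.*2).
- exists 1; case=> // s n a _ n0 a01.
  apply: (@max_rho_alpha_large _ _ _ None (Some (ord0, false)) (Some (ord0, true)));
    rewrite //= /friendship_adj; apply/andP; split=> //; apply/existsP; exists ord0;
    by rewrite !inE !eqxx ?orbT.
Qed.
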